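(* Let $G$ be a finite group generated by pseudoreflections on $\mathbb{C}^n$, let $\Omega\subseteq\mathbb{C}^n$ be a bounded $G$-invariant domain and let $\mathcal{H}\subseteq\mathcal{O}(\Omega)$ be an analytic Hilbert module over $\mathbb{C}[\boldsymbol z]$ with a $G$-invariant reproducing kernel. Suppose that each member of the family $\{\mathbb{P}_\varrho^{ii}\mathcal{H}:\varrho\in\widehat G,\ 1\le i\le\deg\varrho\}$ of reducing submodules of $\mathcal{H}$ over $\mathbb{C}[\boldsymbol z]^G$ is minimal. Then the number of (pairwise unitarily) inequivalent reducing submodules from this family cannot exceed $|\widehat G|$.
   Context: A pseudoreflection on $\mathbb{C}^n$ is a linear map $\rho$ of finite order in $GL(n,\mathbb{C})$ such that $I_n-\rho$ has rank $1$. $\Omega$ is $G$-invariant if $\sigma(\Omega)=\Omega$ for all $\sigma\in G$. $\mathbb{C}[\boldsymbol z]=\mathbb{C}[z_1,\ldots,z_n]$ and $\mathbb{C}[\boldsymbol z]^G$ is its subring of $G$-invariant polynomials. An analytic Hilbert module $\mathcal{H}\subseteq\mathcal{O}(\Omega)$ over $\mathbb{C}[\boldsymbol z]$ is a Hilbert space of holomorphic functions on $\Omega$ with a reproducing kernel $K$, on which multiplication by each polynomial is bounded, and which contains $\mathbb{C}[\boldsymbol z]$ as a dense subspace. $K$ is $G$-invariant if $K(\sigma\boldsymbol z,\sigma\boldsymbol w)=K(\boldsymbol z,\boldsymbol w)$ for all $\sigma\in G$, $\boldsymbol z,\boldsymbol w\in\Omega$. $\mathcal H$ is viewed as a Hilbert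 module over $\mathbb{C}[\boldsymbol z]^G$ by pointwise multiplication. A reducing submodule is a closed subspace invariant under multiplication by all $p\in\mathbb{C}[\boldsymbol z]^G$ and under the adjoints of these operators; it is minimal if the only reducing submodules contained in it are $\{0\}$ and itself. $\widehat G$ is the (finite) set of equivalence classes of irreducible representations of $G$; $\deg\varrho$ is the dimension of $\varrho$. For each $\varrho$ fix a unitary matrix representation $\boldsymbol\pi_\varrho(\sigma)=(\boldsymbol\pi_\varrho^{ij}(\sigma))_{i,j=1}^{\deg\varrho}$ in the class $\varrho$, and put $$\mathbb{P}_\varrho^{ii}f=\frac{\deg\varrho}{|G|}\sum_{\sigma\in G}\boldsymbol\pi_\varrho^{ii}(\sigma^{-1})(f\circ\sigma^{-1}),\quad f\in\mathcal H,$$ an orthogonal projection whose range is a reducing submodule over $\mathbb{C}[\boldsymbol z]^G$. Two submodules $\mathcal{M},\mathcal{N}$ are (unitarily) equivalent over $\mathbb{C}[\boldsymbol z]^G$ if there is a unitary $U:\mathcal{M}\to\mathcal{N}$ with $U(pf)=pU(f)$ for all $p\in\mathbb{C}[\boldsymbol z]^G$, $f\in\mathcal{M}$. *)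

(* Defs.v *)
From HB Require Import structures.
From mathcomp Require Import all_boot all_order all_algebra all_fingroup.
From mathcomp Require Import mxrepresentation.
From mathcomp Require Import complex.
From mathcomp Require Import all_classical all_reals all_analysis.
From mathcomp Require mpoly.

Set Implicit Arguments.
Unset Strict Implicit.
Unset Printing Implicit Defensive.

Import Order.TTheory GRing.Theory Num.Theory numFieldNormedType.Exports.

Local Open Scope classical_set_scope.
Local Open Scope ring_scope.

(* Complex functions on C^n; the codomain is R[i]^o (and not R[i], which is also
   an R-module) so that scaling and differentiability are over R[i]. *)
Notation cplx_fun R n := ('cV[R[i]]_n -> R[i]^o).

(* Convention: a function on Omega is represented by its extension by zero to
   C^n, so that equality of functions on Omega is plain equality. Holomorphy is
   only required at the points of the open set Omega. *)

Section FunctionSpaces.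
Variables (R : realType) (n : nat).
Local Notation C := (R[i]).
Local Notation Cspace := ('cV[C]_n : normedModType C).

Definition bounded_domain (Omega : set 'cV[C]_n) : Prop :=
  let D : set Cspace := Omega in
  [/\ open D, connected D, D !=set0 & bounded_set D].

Definition holomorphic_on (Omega : set 'cV[C]_n) (f : cplx_fun R n) : Prop :=
  forall z : Cspace, Omega z -> differentiable (f : Cspace -> C^o) z.

Definition poly_fun (p : mpoly.mpoly n C) : cplx_fun R n :=
  fun z => mpoly.meval (fun i => z i ord0) p.

Definition zero_ext (Omega : set 'cV[C]_n) (f : cplx_fun R n) : cplx_fun R n :=
  patch (fun=> 0) Omega f.

Definition pmul (p : mpoly.mpoly n C) (f : cplx_fun R n) : cplx_fun R n :=
  fun z => poly_fun p z * f z.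

Definition hnorm (ip : cplx_fun R n -> cplx_fun R n -> C) (f : cplx_fun R n) : R :=
  Num.sqrt (complex.Re (ip f f)).

Definition linear_subspace (M : set (cplx_fun R n)) : Prop :=
  M 0 /\ forall (a : C) f g, M f -> M g -> M (a *: f + g).

(* The values of ip outside H are irrelevant. *)
Record hilbert_function_space (Omega : set 'cV[C]_n) (H : set (cplx_fun R n))
    (ip : cplx_fun R n -> cplx_fun R n -> C) : Prop := {
  hfs_subspace : linear_subspace H;
  hfs_holomorphic : forall f, H f -> holomorphic_on Omega f;
  hfs_supp : forall f, H f -> forall z, ~ Omega z -> f z = 0;
  hfs_linear : forall (a : C) f g h, H f -> H g -> H h ->
    ip (a *: f + g) h = a * ip f h + ip g h;
  hfs_conj : forall f g, H f -> H g -> ip g f = Num.conj (ip f g);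
  hfs_pos : forall f, H f -> f <> 0 -> 0 < ip f f;
  hfs_complete : forall u : nat -> cplx_fun R n, (forall k, H (u k)) ->
    (forall e : R, 0 < e -> exists N : nat, forall j k,
       (N <= j)%N -> (N <= k)%N -> hnorm ip (u j - u k) < e) ->
    exists2 f, H f & (fun k => hnorm ip (u k - f)) @ \oo --> (0 : R)
}.

Definition reproducing_kernel (Omega : set 'cV[C]_n) (H : set (cplx_fun R n))
    (ip : cplx_fun R n -> cplx_fun R n -> C) (K : 'cV[C]_n -> 'cV[C]_n -> C) : Prop :=
  forall w, Omega w ->
    H (fun z => K z w) /\ forall f, H f -> f w = ip f (fun z => K z w).

Record analytic_hilbert_module (Omega : set 'cV[C]_n) (H : set (cplx_fun R n))
    (ip : cplx_fun R n -> cplx_fun R n -> C) (K : 'cV[C]_n -> 'cV[C]_n -> C) : Prop := {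
  ahm_hilbert : hilbert_function_space Omega H ip;
  ahm_kernel : reproducing_kernel Omega H ip K;
  ahm_bounded : forall p, exists c : R, forall f, H f ->
    H (pmul p f) /\ hnorm ip (pmul p f) <= c * hnorm ip f;
  ahm_poly : forall p, H (zero_ext Omega (poly_fun p));
  ahm_dense : forall f, H f -> forall e : R, 0 < e ->
    exists p, hnorm ip (f - zero_ext Omega (poly_fun p)) < e
}.

(* The adjoint on H of a bounded operator T on H; such an h is unique as ip is
   definite on H. *)
Definition adjoint (H : set (cplx_fun R n)) (ip : cplx_fun R n -> cplx_fun R n -> C)
    (T : cplx_fun R n -> cplx_fun R n) (f : cplx_fun R n) : cplx_fun R n :=
  xget 0 [set h | H h /\ forall g, H g -> ip (T g) f = ip g h].

Definition pseudoreflection (A : 'M[C]_n) : Prop :=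
  [/\ A \in unitmx, exists2 k : nat, (0 < k)%N & A ^+ k = 1%:M
    & \rank (1%:M - A) = 1%N].

End FunctionSpaces.

(* A finite subgroup of GL(n, C) is given as a faithful matrix representation rG
   of a finite group G; g acts on column vectors by z |-> rG g *m z. *)
Section GroupActions.
Variables (R : realType) (n : nat) (gT : finGroupType) (G : {group gT}).
Local Notation C := (R[i]).
Variable rG : mx_representation C G n.

Definition generated_by_pseudoreflections : Prop :=
  (<< [set g in G | `[< pseudoreflection (rG g) >] ]%SET >> = G :> {set gT})%g.

Definition invariant_domain (Omega : set 'cV[C]_n) : Prop :=
  forall g, g \in G -> [set rG g *m z | z in Omega] = Omega.

Definition invariant_kernel (Omega : set 'cV[C]_n)
    (K : 'cV[C]_n -> 'cV[C]_n -> C) : Prop :=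
  forall g, g \in G -> forall z w, Omega z -> Omega w ->
    K (rG g *m z) (rG g *m w) = K z w.

Definition invariant_poly (p : mpoly.mpoly n C) : Prop :=
  forall g, g \in G -> forall z, poly_fun p (rG g *m z) = poly_fun p z.

Record reducing_submodule (H : set (cplx_fun R n))
    (ip : cplx_fun R n -> cplx_fun R n -> C) (M : set (cplx_fun R n)) : Prop := {
  red_sub : M `<=` H;
  red_subspace : linear_subspace M;
  red_closed : forall (u : nat -> cplx_fun R n) f, (forall k, M (u k)) -> H f ->
    (fun k => hnorm ip (u k - f)) @ \oo --> (0 : R) -> M f;
  red_mul : forall p, invariant_poly p -> forall f, M f -> M (pmul p f);
  red_adj : forall p, invariant_poly p ->
    forall f, M f -> M (adjoint H ip (pmul p) f)
}.

Definition minimal_submodule (H : set (cplx_fun R n))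
    (ip : cplx_fun R n -> cplx_fun R n -> C) (M : set (cplx_fun R n)) : Prop :=
  forall N, reducing_submodule H ip N -> N `<=` M -> N = [set 0] \/ N = M.

Definition unitarily_equivalent (ip : cplx_fun R n -> cplx_fun R n -> C)
    (M N : set (cplx_fun R n)) : Prop :=
  exists U : cplx_fun R n -> cplx_fun R n,
    [/\ forall (a : C) f g, M f -> M g -> U (a *: f + g) = a *: U f + U g,
        forall f g, M f -> M g -> ip (U f) (U g) = ip f g,
        U @` M = N
      & forall p, invariant_poly p -> forall f, M f ->
          U (pmul p f) = pmul p (U f)].

(* pi picks exactly one unitary matrix representation in each equivalence class
   of irreducible complex representations of G; the finite index type I stands
   for the set of these classes. *)
Record unitary_dual (I : finType) (d : I -> nat)
    (pi : forall r : I, mx_representation C G (d r)) : Prop := {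
  dual_irr : forall r, mx_irreducible (pi r);
  dual_unitary : forall r g, g \in G -> pi r g \is unitarymx;
  dual_inj : forall r s, mx_rsim (pi r) (pi s) -> r = s;
  dual_surj : forall (m : nat) (rho : mx_representation C G m),
    mx_irreducible rho -> exists r, mx_rsim rho (pi r)
}.

(* The operator P_rho^{ii}: f |-> (m / |G|) sum_g rho^{ii}(g^-1) (f o g^-1),
   where m is the degree of rho. *)
Definition rep_proj (m : nat) (rho : mx_representation C G m) (i : 'I_m)
    (f : cplx_fun R n) : cplx_fun R n :=
  fun z => m%:R / #|G|%:R *
    \sum_(g in G) rho (g^-1)%g i i * f (rG (g^-1)%g *m z).

End GroupActions.

(* Main.v *)
Require Import Defs.
From HB Require Import structures.
From mathcomp Require Import all_boot all_order all_algebra all_fingroup.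
From mathcomp Require Import mxrepresentation.
From mathcomp Require Import complex.
From mathcomp Require Import all_classical all_reals all_analysis.
From mathcomp Require Import ring lra.

Import Order.TTheory GRing.Theory Num.Theory numFieldNormedType.Exports.

Local Open Scope classical_set_scope.
Local Open Scope ring_scope.

Set Implicit Arguments.
Unset Strict Implicit.
Unset Printing Implicit Defensive.

(** The submodules P_rho^{ii} H attached to one class rho are all equivalent to
each other, so a pairwise inequivalent subfamily contains at most one of them
for each class, and there are |I| classes.

The equivalences come from the off-diagonal companions of the projections.  For
a unitary irreducible representation rho of degree m put
  E_ij f = (m / |G|) sum_g rho^{ij}(g^-1) (f o g^-1),
so that E_ii is the projection P_rho^{ii}.  Schur orthogonality of the matrix
coefficients makes these operators multiply like (transposed) matrix units,
E_ab E_ce = [a = e] E_cb (matrix_unit_op_comp).  Unitarity of rho, together with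
unitarity of the translations f |-> f o g^-1 on H, gives that E_ji is the
adjoint of E_ij (ip_matrix_unit_op).  Hence E_ij maps E_ii H onto E_jj H with
inverse E_ji, preserves the inner product, and commutes with multiplication by
invariant polynomials, since these commute with the translations.

The analytic content is that translations act unitarily on H
(translate_stable, ip_translate): invariance of K is a statement about the
kernel functions K(., w), which a translation merely permutes, and it must be
carried to all of H.  The kernel functions separate the elements of H, because
<f, K(., w)> = f(w), so their span is dense; a translation is isometric on that
span, hence sends a sequence of the span converging to f to a Cauchy sequence,
whose limit has the pointwise values of f o g^-1 because evaluations are
continuous.

That separating subspaces are dense (total_dense) is proved from completeness
alone: a sequence in the subspace minimizing the distance to f is Cauchy by the
parallelogram law, and a nearly minimal remainder is nearly orthogonal to the
subspace (near_min_orth), which identifies the limit as f. *)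

(** * Schur orthogonality *)

Section Schur.
Variables (F : closedFieldType) (gT : finGroupType) (G : {group gT}).
Hypothesis F0 : [pchar F] =i pred0.
Variables (m : nat) (rho : mx_representation F G m).
Hypothesis irr : mx_irreducible rho.

Lemma schur_scalar (A : 'M[F]_m) :
  (forall g, g \in G -> A *m rho g = rho g *m A) -> exists c, A = c%:M.
Proof.
move=> cA.
have absr := group_closure_closed_field irr.
apply/is_scalar_mxP/(mx_abs_irr_cent_scalar absr).
by apply/centgmxP.
Qed.

(** Averaging the elementary matrix E_be over conjugation by rho produces a
scalar matrix; its trace gives the scalar and its (a, c) entry is the sum. *)
Lemma schur_orthogonality (a b e c : 'I_m) :
  \sum_(g in G) rho (g^-1)%g a b * rho g e c
    = #|G|%:R / m%:R * ((a == c)%:R * (b == e)%:R) :> F.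
Proof.
pose X := \sum_(g in G) rho (g^-1)%g *m delta_mx b e *m rho g.
have Xac : X a c = \sum_(g in G) rho (g^-1)%g a b * rho g e c.
  rewrite summxE; apply: eq_bigr => g _; rewrite mxE (bigD1 e) //= big1 ?addr0.
    rewrite mxE (bigD1 b) //= big1 ?addr0 ?mxE ?eqxx ?mulr1 // => j /negPf nj.
    by rewrite mxE nj mulr0.
  move=> j /negPf nj; rewrite mxE big1 ?mul0r // => k _.
  by rewrite mxE nj andbF mulr0.
have [|x Xx] := @schur_scalar X.
  move=> h Gh; rewrite mulmx_suml mulmx_sumr.
  rewrite [RHS](reindex_inj (mulIg h)) /=.
  rewrite [RHS](eq_bigl (fun g => g \in G)) => [|g]; last by rewrite groupMr.
  apply: eq_bigr => g Gg; rewrite invMg !repr_mxM ?groupV //.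
  by rewrite !mulmxA -repr_mxM ?groupV // mulgV repr_mx1 mul1mx.
rewrite -Xac Xx !mxE.
have tr_delta : \tr (delta_mx b e : 'M[F]_m) = (b == e)%:R.
  rewrite /mxtrace (bigD1 b) //= big1 => [|j /negPf nj]; rewrite mxE ?nj //.
  by rewrite eqxx addr0.
have mx0 : x *+ m = #|G|%:R * (b == e)%:R.
  rewrite -mxtrace_scalar -Xx raddf_sum /= -tr_delta mulr_natl -sumr_const.
  apply: eq_bigr => g Gg; rewrite mxtrace_mulC mulmxA -repr_mxM ?groupV //.
  by rewrite mulgV repr_mx1 mul1mx.
have m0 : m%:R != 0 :> F.
  by have /pcharf0P -> := F0; rewrite -lt0n (leq_ltn_trans _ (ltn_ord a)).
rewrite [X in _ = _ * X]mulrC mulrA [X in _ = X * _]mulrAC -mx0.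
rewrite -[x *+ m]mulr_natr mulfK //.
by rewrite mulr_natr.
Qed.
End Schur.

(** * Hilbert spaces of functions *)

Section HilbertFunctionSpace.
Variables (R : realType) (n : nat).
Local Notation C := (R[i]).
Local Notation fct := (cplx_fun R n).

Definition sqnorm (ip : fct -> fct -> C) (f : fct) : R := complex.Re (ip f f).

Section Subspace.
Variables (M : set fct).
Hypothesis sM : linear_subspace M.

Lemma subspace0 : M 0. Proof. by case: sM. Qed.

Lemma subspaceD f g : M f -> M g -> M (f + g).
Proof. by move=> Mf Mg; rewrite -[f]scale1r; apply: sM.2. Qed.

Lemma subspaceZ a f : M f -> M (a *: f).
Proof.
move=> Mf; rewrite -[_ *: f]addr0; apply: sM.2 => //; exact: subspace0.
Qed.

Lemma subspaceB f g : M f -> M g -> M (f - g).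
Proof. by move=> Mf Mg; rewrite -scaleN1r addrC; apply: sM.2. Qed.

Lemma subspace_sum (T : finType) (P : pred T) (F : T -> fct) :
  (forall t, P t -> M (F t)) -> M (\sum_(t | P t) F t).
Proof.
by move=> MF; apply: big_ind => //; [apply: subspace0 | apply: subspaceD].
Qed.
End Subspace.

Variables (Omega : set 'cV[C]_n) (H : set fct) (ip : fct -> fct -> C).
Hypothesis hH : hilbert_function_space Omega H ip.

Let sH : linear_subspace H := hfs_subspace hH.

Lemma ipDl f g h : H f -> H g -> H h -> ip (f + g) h = ip f h + ip g h.
Proof.
by move=> Hf Hg Hh; rewrite -[f]scale1r (hfs_linear hH) // mul1r scale1r.
Qed.

Lemma ip0l h : H h -> ip 0 h = 0.
Proof.
move=> Hh; have H0 := subspace0 sH.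
have := ipDl H0 H0 Hh; rewrite addr0 => e.
by apply: (addrI (ip 0 h)); rewrite addr0 -e.
Qed.

Lemma ipZl a f h : H f -> H h -> ip (a *: f) h = a * ip f h.
Proof.
move=> Hf Hh; rewrite -[a *: f]addr0 (hfs_linear hH) ?ip0l ?addr0 //.
exact: subspace0.
Qed.

Lemma ipBl f g h : H f -> H g -> H h -> ip (f - g) h = ip f h - ip g h.
Proof.
move=> Hf Hg Hh; rewrite -[- g]scaleN1r addrC (hfs_linear hH) //.
by rewrite mulN1r addrC.
Qed.

Lemma ip_suml (T : finType) (P : pred T) (F : T -> fct) h :
  (forall t, P t -> H (F t)) -> H h ->
  ip (\sum_(t | P t) F t) h = \sum_(t | P t) ip (F t) h.
Proof.
move=> HF Hh.
suff [] : ip (\sum_(t | P t) F t) h = \sum_(t | P t) ip (F t) h /\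
     H (\sum_(t | P t) F t) by [].
apply: (big_ind2 (fun x y => ip x h = y /\ H x)) => [|x x' y y'|t Pt].
- by split; [apply: ip0l | apply: subspace0].
- by move=> [<- Hx] [<- Hy]; split; [apply: ipDl | apply: subspaceD].
- by split=> //; apply: HF.
Qed.

Lemma ipC f g : H f -> H g -> ip g f = Num.conj (ip f g).
Proof. exact: (hfs_conj hH). Qed.

Lemma ipDr f g h : H f -> H g -> H h -> ip h (f + g) = ip h f + ip h g.
Proof.
move=> Hf Hg Hh; rewrite ipC ?ipDl ?rmorphD //=; last exact: subspaceD.
by rewrite -!ipC.
Qed.

Lemma ipZr a f h : H f -> H h -> ip h (a *: f) = Num.conj a * ip h f.
Proof.
move=> Hf Hh; rewrite ipC ?ipZl ?rmorphM //=; last exact: subspaceZ.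
by rewrite -ipC.
Qed.

Lemma ipBr f g h : H f -> H g -> H h -> ip h (f - g) = ip h f - ip h g.
Proof.
move=> Hf Hg Hh; rewrite ipC ?ipBl ?rmorphB //=; last exact: subspaceB.
by rewrite -!ipC.
Qed.

Lemma ip0r h : H h -> ip h 0 = 0.
Proof.
move=> Hh; rewrite -(scale0r (0 : fct)) ipZr ?rmorph0 ?mul0r //.
exact: subspace0.
Qed.

Lemma ip_sumr (T : finType) (P : pred T) (F : T -> fct) h :
  (forall t, P t -> H (F t)) -> H h ->
  ip h (\sum_(t | P t) F t) = \sum_(t | P t) ip h (F t).
Proof.
move=> HF Hh; rewrite ipC ?ip_suml ?rmorph_sum //=; last exact: subspace_sum.
by apply: eq_bigr => t Pt; rewrite -ipC //; apply: HF.
Qed.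

Local Notation N := (sqnorm ip).

Lemma ip_ge0 f : H f -> 0 <= ip f f.
Proof.
move=> Hf; have [->|/eqP f0] := eqVneq f 0.
  by rewrite ip0l //; apply: subspace0.
exact/ltW/(hfs_pos hH).
Qed.

Lemma ip_sqnorm f : H f -> ip f f = (N f)%:C%C.
Proof. by move=> /ip_ge0/ger0_real/RRe_real ->. Qed.

Lemma sqnorm_ge0 f : H f -> 0 <= N f.
Proof. by move=> Hf; rewrite -ler0c -ip_sqnorm // ip_ge0. Qed.

(** Replacing f by f - t k lowers the squared norm by |<f, k>|^2 / <k, k> for
the best t, so a vector whose squared norm is within e of a lower bound along
the line f + C k is nearly orthogonal to k.  The lower bound 0 gives the
Cauchy-Schwarz inequality, the infimum over a subspace gives density. *)
Lemma near_min_orth (m e : R) f k : H f -> H k ->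
  (forall t : C, m <= N (f - t *: k)) -> N f <= m + e ->
  `|ip f k| ^+ 2 <= (e * N k)%:C%C.
Proof.
move=> Hf Hk min_m fme.
have [->|/eqP k0] := eqVneq k 0.
  by rewrite ip0r // normr0 expr0n /= /sqnorm ip0r ?mulr0 //; apply: subspace0.
have kk : 0 < ip k k by apply: (hfs_pos hH).
pose t := ip f k / ip k k.
have Hft : H (f - t *: k) by apply: subspaceB => //; apply: subspaceZ.
have : m%:C%C <= ip (f - t *: k) (f - t *: k).
  by rewrite ip_sqnorm // lecR.
rewrite ipBl ?ipBr ?ipZl ?ipZr //; try exact: subspaceZ.
have -> : ip k f = Num.conj (ip f k) by rewrite -ipC.
have tk : t * ip k k = ip f k by rewrite /t divfK // gt_eqF.
have -> : t * (Num.conj t * ip k k) = Num.conj t * ip f k by rewrite mulrCA tk.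
rewrite opprB addrA subrK /t mulrAC -normCK lerBrDr -lerBrDl.
move=> mt; rewrite rmorphM /= -ip_sqnorm // -ler_pdivrMr //.
apply: le_trans mt _; rewrite lerBlDl -rmorphD /= ip_sqnorm //.
by rewrite lecR.
Qed.

Lemma CauchySchwarz f k : H f -> H k -> `|ip f k| ^+ 2 <= (N f * N k)%:C%C.
Proof.
move=> Hf Hk; apply: (@near_min_orth 0) => // [t|]; last by rewrite add0r.
by apply: sqnorm_ge0; apply: subspaceB => //; apply: subspaceZ.
Qed.

Lemma sqnormD f g : H f -> H g -> N (f + g) + N (f - g) = 2 * N f + 2 * N g.
Proof.
move=> Hf Hg; apply: complexI; rewrite !rmorphD !rmorphM /= rmorph_nat.
rewrite -!ip_sqnorm //; try exact: subspaceB; try exact: subspaceD.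
rewrite ipDl ?ipBl ?ipBr ?ipDr //; try exact: subspaceB; try exact: subspaceD.
ring.
Qed.

Lemma sqnormZ a f : H f -> ip (a *: f) (a *: f) = `|a| ^+ 2 * ip f f.
Proof.
by move=> Hf; rewrite ipZl ?ipZr ?mulrA -?normCK //; apply: subspaceZ.
Qed.

Lemma hnorm_lt f (e : R) : 0 < e -> N f < e ^+ 2 -> hnorm ip f < e.
Proof.
move=> e0 Ne; rewrite /hnorm -/(N f) -(ger0_norm (ltW e0)) -sqrtr_sqr.
by rewrite ltr_sqrt // exprn_gt0.
Qed.

Lemma hnorm_sqr f : H f -> hnorm ip f ^+ 2 = N f.
Proof. by move=> Hf; rewrite /hnorm sqr_sqrtr //; apply: sqnorm_ge0. Qed.
Lemma cvg_sqr_bound (a : nat -> C^o) (l : C^o) (e : nat -> R) :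
  (forall j, `|l - a j| ^+ 2 <= (e j)%:C%C) -> e @ \oo --> (0 : R) ->
  a @ \oo --> l.
Proof.
move=> ae e0; apply/cvgrPdist_lt => eps eps0.
have epsE : eps = (complex.Re eps)%:C%C by rewrite RRe_real // gtr0_real.
have r0 : 0 < complex.Re eps by move: eps0; rewrite epsE ltcR.
have /cvgrPdist_lt/(_ _ (exprn_gt0 2 r0)) := e0.
apply: filterS => j; rewrite sub0r normrN => ej.
rewrite -(@ltr_pXn2r _ 2) ?nnegrE ?normr_ge0 ?(ltW eps0) //.
apply: le_lt_trans (ae j) _.
by rewrite epsE -rmorphXn /= ltcR; apply: le_lt_trans ej; rewrite ler_norm.
Qed.

Lemma cvg_ip (u : nat -> fct) f g : (forall j, H (u j)) -> H f -> H g ->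
  (fun j => hnorm ip (u j - f)) @ \oo --> (0 : R) ->
  (fun j => ip (u j) g : C^o) @ \oo --> (ip f g : C^o).
Proof.
move=> Hu Hf Hg uf.
apply: (@cvg_sqr_bound _ _ (fun j => hnorm ip (u j - f) ^+ 2 * N g)) => [j|].
  have Huf := subspaceB sH (Hu j) Hf.
  by rewrite distrC -ipBl // hnorm_sqr //; apply: CauchySchwarz.
rewrite -(mul0r (N g)) -(mulr0 (0 : R)); apply: cvgMl.
exact: (cvgM uf uf).
Qed.

(** * Density of separating subspaces *)

Section Density.
Variable D : set fct.
Hypotheses (sD : linear_subspace D) (DH : D `<=` H).
Hypothesis total_D : forall f h, H f -> H h ->
  (forall k, D k -> ip f k = ip h k) -> f = h.

(** The limit h of a minimizing sequence (u_j) satisfies <h, k> = <f, k> for all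
k in D, by near_min_orth on one side and continuity on the other, so h = f. *)
Lemma total_dense f : H f -> exists2 u : nat -> fct, forall j, D (u j) &
  (fun j => hnorm ip (u j - f)) @ \oo --> (0 : R).
Proof.
move=> Hf; pose S := [set N (f - k) | k in D]; pose m := inf S.
have HB k : D k -> H (f - k) by move=> /DH; apply: subspaceB.
have S0 : lbound S 0 by move=> _ [k Dk <-]; apply/sqnorm_ge0/HB.
have infS : has_inf S.
  by split; [exists (N (f - 0)), 0 => //; apply: subspace0 | exists 0].
have min_m k : D k -> m <= N (f - k)
  by move=> Dk; apply: ge_inf infS.2 _ _; exists k.
have /choice [u u_near] :
    forall j, exists k, D k /\ N (f - k) < m + j.+1%:R^-1.
  move=> j; have [_ [k Dk <-] mk] : exists2 x, S x & x < m + j.+1%:R^-1.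
    by apply: inf_adherent => //; rewrite invr_gt0.
  by exists k.
have Du j : D (u j) by case: (u_near j).
have um j : N (f - u j) < m + j.+1%:R^-1 by case: (u_near j).
have Hu j : H (u j) by apply: DH.
have u_orth k : D k -> (fun j => ip (u j) k : C^o) @ \oo --> (ip f k : C^o).
  move=> Dk; apply: (@cvg_sqr_bound _ _ (fun j => j.+1%:R^-1 * N k)) => [j|].
    rewrite -ipBl //; last exact: DH.
    apply: (@near_min_orth m); [exact: HB | exact: DH | move=> t | exact/ltW].
    rewrite -addrA -opprD; apply: min_m.
    by apply: subspaceD => //; apply: subspaceZ.
  rewrite -(mul0r (N k)); apply: cvgMl; exact: cvg_harmonic.
(* The parallelogram law for f - u_k and f - u_j: their half sum is f minus a
   point of D, so its squared norm is at least m. *)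
have u_cauchy j k : N (u j - u k) <= 2 * j.+1%:R^-1 + 2 * k.+1%:R^-1.
  have := sqnormD (HB _ (Du k)) (HB _ (Du j)).
  have -> : f - u k - (f - u j) = u j - u k.
    by rewrite opprB addrC addrA subrK.
  have -> : f - u k + (f - u j) = 2 *: (f - 2^-1 *: (u k + u j)).
    rewrite scalerBr scalerA divff ?pnatr_eq0 // scale1r scaler_nat mulr2n.
    by rewrite opprD addrACA.
  have mid : m <= N (f - 2^-1 *: (u k + u j)).
    by apply: min_m; apply: subspaceZ => //; apply: subspaceD.
  have Hmid : H (f - 2^-1 *: (u k + u j)).
    by apply: HB; apply: subspaceZ => //; apply: subspaceD.
  rewrite {1}/sqnorm sqnormZ // ip_sqnorm //.
  rewrite ger0_norm // -natrX -(rmorph_nat (real_complex R)) -rmorphM /=.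
  have := um j; have := um k.
  move: (j.+1%:R^-1) (k.+1%:R^-1) => a b; rewrite -[(2 ^ 2)%N]/4%N; lra.
have [|h Hh uh] := hfs_complete hH Hu.
  move=> e e0; have e4 : 0 < e ^+ 2 / 4 by rewrite divr_gt0 ?exprn_gt0.
  have [M _ HM] := near_infty_natSinv_lt (PosNum e4).
  exists M => j k Mj Mk; apply: hnorm_lt => //.
  apply: le_lt_trans (u_cauchy j k) _.
  have := HM _ Mj; have := HM _ Mk => /=.
  move: (j.+1%:R^-1) (k.+1%:R^-1) (e ^+ 2) => a b c; lra.
exists u => //; rewrite (_ : f = h) //; apply: total_D => // k Dk.
apply: (@cvg_unique _ (@norm_hausdorff _ C^o) _ _ _ _ (u_orth k Dk)).
by apply: cvg_ip => //; apply: DH.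
Qed.

End Density.
End HilbertFunctionSpace.

(** * Unitarity of the translations *)

Section Translation.
Variables (R : realType) (n : nat) (gT : finGroupType) (G : {group gT}).
Local Notation C := (R[i]).
Local Notation fct := (cplx_fun R n).
Variable rG : mx_representation C G n.

Definition translate (g : gT) (f : fct) : fct := fun z => f (rG (g^-1)%g *m z).

Lemma translateB g f h : translate g (f - h) = translate g f - translate g h.
Proof. by []. Qed.

Lemma translate_linear g a f h :
  translate g (a *: f + h) = a *: translate g f + translate g h.
Proof. by []. Qed.

Lemma translateK g : g \in G -> cancel (translate g) (translate g^-1).
Proof.
move=> Gg f; apply/funext => z.
by rewrite /translate invgK mulmxA -repr_mxM ?groupV // mulVg repr_mx1 mul1mx.
Qed.

Variables (Omega : set 'cV[C]_n) (H : set fct) (ip : fct -> fct -> C).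
Variable K : 'cV[C]_n -> 'cV[C]_n -> C.
Hypothesis hH : hilbert_function_space Omega H ip.
Hypothesis rK : reproducing_kernel Omega H ip K.
Hypothesis iO : invariant_domain rG Omega.
Hypothesis iK : invariant_kernel rG Omega K.

Let sH : linear_subspace H := hfs_subspace hH.
Local Notation Kfun w := ((fun z => K z w) : fct).

Lemma invariant_domainE g z : g \in G -> Omega (rG g *m z) <-> Omega z.
Proof.
move=> Gg; split => [Ogz|Oz]; last by rewrite -(iO Gg); exists z.
rewrite -(iO (groupVr Gg)); exists (rG g *m z) => //.
by rewrite mulmxA -repr_mxM ?groupV // mulVg repr_mx1 mul1mx.
Qed.

(** Outside Omega both sides vanish, since Omega is invariant; inside, this is
the invariance of K. *)
Lemma translate_kernel g w : g \in G -> Omega w ->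
  translate g (Kfun w) = Kfun (rG g *m w).
Proof.
move=> Gg Ow; apply/funext => z; rewrite /translate.
have Ogw : Omega (rG g *m w) by apply/invariant_domainE.
have zE : z = rG g *m (rG (g^-1)%g *m z).
  by rewrite mulmxA -repr_mxM ?groupV // mulgV repr_mx1 mul1mx.
have [Oz|nOz] := pselect (Omega z).
  rewrite [in RHS]zE iK //; apply/invariant_domainE => //.
  by rewrite groupV.
rewrite (hfs_supp hH (rK Ogw).1 nOz) (hfs_supp hH (rK Ow).1) //.
by move/invariant_domainE => /(_ (groupVr Gg)).
Qed.

(** The linear span of the kernel functions, as the intersection of all
subspaces containing them: the definition is its own induction principle. *)
Definition kernel_span (k : fct) : Prop :=
  forall M : set fct, linear_subspace M ->
    (forall w, Omega w -> M (Kfun w)) -> M k.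

Lemma kernel_span_subspace : linear_subspace kernel_span.
Proof.
split=> [M sM _|a f h Df Dh M sM MK]; first exact: subspace0.
by apply: sM.2; [apply: Df | apply: Dh].
Qed.

Lemma kernel_span_kernel w : Omega w -> kernel_span (Kfun w).
Proof. by move=> Ow M sM; apply. Qed.

Lemma kernel_span_sub : kernel_span `<=` H.
Proof. by move=> k Dk; apply: (Dk H) => // w /rK[]. Qed.

Lemma kernel_span_translate g k : g \in G ->
  kernel_span k -> kernel_span (translate g k).
Proof.
move=> Gg Dk; apply: (Dk (fun k => kernel_span (translate g k))); first split.
- exact: (subspace0 kernel_span_subspace).
- by move=> a f h Df Dh; rewrite translate_linear; apply: kernel_span_subspace.2.
- move=> w Ow; rewrite translate_kernel //; apply: kernel_span_kernel.
  exact/invariant_domainE.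
Qed.

Lemma eq_on_domain f h : H f -> H h ->
  (forall w, Omega w -> f w = h w) -> f = h.
Proof.
move=> Hf Hh fh; apply/funext => z; have [/fh //|nOz] := pselect (Omega z).
by rewrite (hfs_supp hH Hf) // (hfs_supp hH Hh).
Qed.

(** Inner products with the kernel functions are the values of a function. *)
Lemma kernel_span_dense f : H f -> exists2 u : nat -> fct,
  forall j, kernel_span (u j) & (fun j => hnorm ip (u j - f)) @ \oo --> (0 : R).
Proof.
apply: (total_dense hH kernel_span_subspace kernel_span_sub) => f' h Hf Hh fh.
apply: eq_on_domain => // w Ow.
by rewrite (rK Ow).2 // (rK Ow).2 // fh //; apply: kernel_span_kernel.
Qed.

(** For k = K(., w) both sides are the value of f at g^-1 w.  That the
translate of f lies in H is assumed because the general fact (translate_stable)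
is deduced from this lemma for f in the span. *)
Lemma ip_translate_span g f k : g \in G -> H f -> H (translate g f) ->
  kernel_span k -> ip (translate g f) k = ip f (translate g^-1 k).
Proof.
move=> Gg Hf Hgf Dk.
suff [] : kernel_span k /\ ip (translate g f) k = ip f (translate g^-1 k) by [].
have GVg := groupVr Gg.
have DH k' : kernel_span k' -> H (translate g^-1 k').
  by move=> Dk'; apply: kernel_span_sub; apply: kernel_span_translate.
apply: (Dk (fun k => _ k /\ ip _ k = ip f (translate _ k))); first split.
- split; first exact: (subspace0 kernel_span_subspace).
  by rewrite (ip0r hH) // (_ : translate _ 0 = 0) // (ip0r hH).
- move=> a k1 k2 [D1 e1] [D2 e2]; split; first exact: kernel_span_subspace.2.
  rewrite translate_linear.
  have aD1 := subspaceZ kernel_span_subspace a D1.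
  rewrite (ipDr hH) ?(ipZr hH) ?e1 ?e2 //; try exact: kernel_span_sub.
  rewrite (ipDr hH) ?(ipZr hH) //; try exact: DH.
  by apply: (subspaceZ sH); apply: DH.
- move=> w Ow; split; first exact: kernel_span_kernel.
  have OVw : Omega (rG (g^-1)%g *m w) by apply/invariant_domainE.
  by rewrite translate_kernel // -(rK Ow).2 // -(rK OVw).2.
Qed.

Lemma hnorm_translate_span g k : g \in G -> kernel_span k ->
  hnorm ip (translate g k) = hnorm ip k.
Proof.
move=> Gg Dk; have Dgk := kernel_span_translate Gg Dk.
by rewrite /hnorm ip_translate_span ?translateK //; apply: kernel_span_sub.
Qed.

Lemma cvg_eval u f w : (forall j, H (u j)) -> H f -> Omega w ->
  (fun j => hnorm ip (u j - f)) @ \oo --> (0 : R) ->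
  (fun j => u j w : C^o) @ \oo --> (f w : C^o).
Proof.
move=> Hu Hf Ow uf; rewrite (rK Ow).2 //.
have -> : (fun j => u j w : C^o) = (fun j => ip (u j) (Kfun w) : C^o).
  by apply/funext => j; rewrite (rK Ow).2.
by apply: (cvg_ip hH) => //; apply: (rK Ow).1.
Qed.

(** Translates of a sequence in the span converging to f form a Cauchy sequence;
its limit agrees pointwise with the translate of f.  The approximating sequence
is kept in the conclusion because the adjunction ip_translate needs convergence
of the sequence and of its translate at once. *)
Lemma translate_approx g f : g \in G -> H f -> H (translate g f) /\
  exists u : nat -> fct, [/\ forall j, kernel_span (u j),
    (fun j => hnorm ip (u j - f)) @ \oo --> (0 : R) &
    (fun j => hnorm ip (translate g (u j) - translate g f)) @ \oo --> (0 : R)].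
Proof.
move=> Gg Hf; have [u Du uf] := kernel_span_dense Hf.
have Hu j := kernel_span_sub (Du j).
pose v j := translate g (u j).
have Dv j : kernel_span (v j) by apply: kernel_span_translate.
have Hv j := kernel_span_sub (Dv j).
have vB j k : hnorm ip (v j - v k) = hnorm ip (u j - u k).
  rewrite /v -translateB hnorm_translate_span //.
  exact: (subspaceB kernel_span_subspace).
have [|h Hh vh] := hfs_complete hH Hv.
  move=> e e0; have e4 : 0 < e ^+ 2 / 4 by rewrite divr_gt0 ?exprn_gt0.
  (* By the parallelogram law |u_j - u_k|^2 is at most
     2 |u_j - f|^2 + 2 |u_k - f|^2, hence the bound e^2 / 4. *)
  have uf2 : (fun j => hnorm ip (u j - f) ^+ 2) @ \oo --> (0 : R).
    by rewrite -(mulr0 (0 : R)); apply: (cvgM uf uf).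
  have /cvgrPdist_lt/(_ _ e4) [M _ HM] := uf2.
  have {}HM j : (M <= j)%N -> sqnorm ip (u j - f) < e ^+ 2 / 4.
    move=> /HM /=; rewrite sub0r normrN; apply: le_lt_trans.
    by rewrite (hnorm_sqr hH) ?ler_norm //; apply: subspaceB.
  exists M => j k Mj Mk; rewrite vB.
  apply: hnorm_lt => //.
  have Hj := subspaceB sH (Hu j) Hf; have Hk := subspaceB sH (Hu k) Hf.
  have := sqnormD hH Hj Hk.
  have -> : u j - f - (u k - f) = u j - u k.
    by rewrite opprB addrA subrK.
  have := sqnorm_ge0 hH (subspaceD sH Hj Hk).
  have := HM _ Mj; have := HM _ Mk; move: (e ^+ 2) => c; lra.
(* Values of a limit in H are limits of values, so h(w) = lim u_j(g^-1 w). *)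
suff hE : h = translate g f by rewrite -hE; split => //; exists u.
apply/funext => w; have [Ow|nOw] := pselect (Omega w); last first.
  rewrite (hfs_supp hH Hh) // /translate (hfs_supp hH Hf) //.
  by move/invariant_domainE => /(_ (groupVr Gg)).
have OVw : Omega (rG (g^-1)%g *m w).
  by apply/invariant_domainE => //; rewrite groupV.
apply: (@cvg_unique _ (@norm_hausdorff _ C^o) _ _ _ _ (cvg_eval Hv Hh Ow vh)).
exact: (cvg_eval Hu Hf OVw uf).
Qed.

Lemma translate_stable g f : g \in G -> H f -> H (translate g f).
Proof. by move=> Gg Hf; case: (translate_approx Gg Hf). Qed.

Lemma ip_translate g f h : g \in G -> H f -> H h ->
  ip (translate g f) h = ip f (translate g^-1 h).
Proof.
move=> Gg Hf Hh; have GVg := groupVr Gg.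
have Hgf := translate_stable Gg Hf.
have [HVh [u [Du uh Vuh]]] := translate_approx GVg Hh.
have Hu j := kernel_span_sub (Du j).
have HVu j := kernel_span_sub (kernel_span_translate GVg (Du j)).
rewrite (ipC hH Hh Hgf) (ipC hH HVh Hf); congr (Num.conj _).
have := cvg_ip hH HVu HVh Hf Vuh.
have -> : (fun j => ip (translate g^-1 (u j)) f : C^o) =
          (fun j => ip (u j) (translate g f) : C^o).
  apply/funext => j; rewrite (ipC hH Hgf (Hu j)) (ipC hH Hf (HVu j)).
  by rewrite ip_translate_span.
by apply: (@cvg_unique _ (@norm_hausdorff _ C^o)); apply: (cvg_ip hH).
Qed.

(** * Matrix unit operators *)

Section MatrixUnits.
Variables (m : nat) (rho : mx_representation C G m).

(** For i = j this unfolds to rep_proj. *)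
Definition matrix_unit_op (i j : 'I_m) (f : fct) : fct :=
  fun z => m%:R / #|G|%:R *
    \sum_(g in G) rho (g^-1)%g i j * f (rG (g^-1)%g *m z).

Lemma matrix_unit_opE i j f : matrix_unit_op i j f =
  \sum_(g in G) (m%:R / #|G|%:R * rho (g^-1)%g i j) *: translate g f.
Proof.
apply/funext => z; rewrite fct_sumE /matrix_unit_op mulr_sumr.
by apply: eq_bigr => g _; rewrite mulrA.
Qed.

Lemma matrix_unit_op_linear i j a f h :
  matrix_unit_op i j (a *: f + h) =
  a *: matrix_unit_op i j f + matrix_unit_op i j h.
Proof.
rewrite !matrix_unit_opE scaler_sumr -big_split; apply: eq_bigr => g _ /=.
by rewrite translate_linear scalerDr !scalerA [_ * a]mulrC.
Qed.

Lemma matrix_unit_op_pmul i j p f : invariant_poly rG p ->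
  matrix_unit_op i j (pmul p f) = pmul p (matrix_unit_op i j f).
Proof.
move=> ip_p; apply/funext => z; rewrite /pmul /matrix_unit_op [RHS]mulrCA.
congr (_ * _); rewrite mulr_sumr; apply: eq_bigr => g Gg.
by rewrite ip_p ?groupV // mulrCA.
Qed.

Lemma matrix_unit_op_stable i j f : H f -> H (matrix_unit_op i j f).
Proof.
move=> Hf; rewrite matrix_unit_opE; apply: subspace_sum => // g Gg.
by apply: subspaceZ => //; apply: translate_stable.
Qed.

(** The adjoint of the translation by g is the translation by g^-1, and
unitarity turns the conjugate of rho^{ij}(g^-1) into rho^{ji}(g). *)
Lemma ip_matrix_unit_op i j f h :
  (forall g, g \in G -> rho g \is unitarymx) -> H f -> H h ->
  ip (matrix_unit_op i j f) h = ip f (matrix_unit_op j i h).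
Proof.
move=> rhoU Hf Hh; rewrite !matrix_unit_opE.
rewrite (ip_suml hH) // => [|g Gg]; last first.
  by apply: subspaceZ => //; apply: translate_stable.
rewrite (ip_sumr hH) // => [|g Gg]; last first.
  by apply: subspaceZ => //; apply: translate_stable.
rewrite [RHS](reindex_inj invg_inj) /=.
rewrite [RHS](eq_bigl (fun g => g \in G)) => [|g]; last by rewrite groupV.
apply: eq_bigr => g Gg; have GVg := groupVr Gg.
have Hgf := translate_stable Gg Hf; have HVh := translate_stable GVg Hh.
rewrite (ipZl hH) // (ipZr hH) // ip_translate // invgK.
congr (_ * _); rewrite !rmorphM fmorphV !rmorph_nat; congr (_ * _).
have : rho (g^-1)%g = (rho g)^t*%sesqui.
  rewrite repr_mxV // invmx_unitary //; exact: rhoU.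
by move=> ->; rewrite !mxE.
Qed.

Hypothesis irr : mx_irreducible rho.

(** In the double sum over g, h, the substitution h := g^-1 h makes the function
depend on h alone; after rho^{ce}(h^-1 g) is expanded as a matrix product, the
sum over g is the one evaluated by Schur orthogonality. *)
Lemma matrix_unit_op_comp a b c e f :
  matrix_unit_op a b (matrix_unit_op c e f) =
  (a == e)%:R *: matrix_unit_op c b f.
Proof.
pose q : C := m%:R / #|G|%:R; apply/funext => z; rewrite /matrix_unit_op -/q.
transitivity (q * (q * \sum_(h in G) \sum_(g in G) \sum_k
    (rho (g^-1)%g a b * rho g k e) * (rho (h^-1)%g c k * f (rG (h^-1)%g *m z)))).
  congr (_ * _); rewrite exchange_big mulr_sumr; apply: eq_bigr => g Gg /=.
  rewrite mulrCA; congr (_ * _); rewrite mulr_sumr.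
  rewrite [RHS](reindex_inj (mulgI g)) /=.
  rewrite [RHS](eq_bigl (fun h => h \in G)) => [|h]; last by rewrite groupMl.
  apply: eq_bigr => h Gh; rewrite invMg mulmxA -repr_mxM ?groupV //.
  have -> : rho (h^-1)%g c e = \sum_k rho (h^-1 * g^-1)%g c k * rho g k e.
    rewrite -[in LHS](mulgKV g h^-1)%g repr_mxM ?groupM ?groupV //.
    by rewrite mxE.
  rewrite mulr_suml mulr_sumr; apply: eq_bigr => k _.
  by rewrite [RHS]mulrACA -!mulrA.
have qN : q * (#|G|%:R / m%:R) = 1.
  rewrite /q mulrA divfK ?mulfV ?pnatr_eq0 -?lt0n ?cardG_gt0 //.
  by rewrite (leq_ltn_trans _ (ltn_ord a)).
rewrite /GRing.scale /= [RHS]mulrCA; congr (_ * _).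
rewrite [LHS]mulr_sumr [RHS]mulr_sumr; apply: eq_bigr => h Gh.
rewrite exchange_big /=.
have inner k : \sum_(g in G) rho (g^-1)%g a b * rho g k e *
      (rho (h^-1)%g c k * f (rG (h^-1)%g *m z)) =
    #|G|%:R / m%:R * ((a == e)%:R * (b == k)%:R) *
      (rho (h^-1)%g c k * f (rG (h^-1)%g *m z)).
  by rewrite -mulr_suml schur_orthogonality //; apply: pchar_num.
rewrite (bigD1 b) //= [X in _ + X]big1 ?addr0 => [|k]; rewrite inner.
  by rewrite eqxx mulr1 -[X in q * X]mulrA [LHS]mulrA qN mul1r.
by rewrite eq_sym => /negPf ->; rewrite !mulr0 mul0r.
Qed.

End MatrixUnits.
End Translation.

Theorem corollary6p11 (R : realType) (n : nat)
    (gT : finGroupType) (G : {group gT}) (rG : mx_representation R[i] G n)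
    (Omega : set 'cV[R[i]]_n) (H : set (cplx_fun R n))
    (ip : cplx_fun R n -> cplx_fun R n -> R[i])
    (K : 'cV[R[i]]_n -> 'cV[R[i]]_n -> R[i])
    (I : finType) (d : I -> nat)
    (pi : forall r : I, mx_representation R[i] G (d r)) :
  mx_faithful rG ->
  generated_by_pseudoreflections rG ->
  bounded_domain Omega ->
  invariant_domain rG Omega ->
  analytic_hilbert_module Omega H ip K ->
  invariant_kernel rG Omega K ->
  unitary_dual pi ->
  (forall (r : I) (i : 'I_(d r)),
     minimal_submodule rG H ip (rep_proj rG (pi r) i @` H)) ->
  forall S : {set {r : I & 'I_(d r)}},
    (forall a b, a \in S -> b \in S -> a != b ->
       ~ unitarily_equivalent rG ip
           (rep_proj rG (pi (tag a)) (tagged a) @` H)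
           (rep_proj rG (pi (tag b)) (tagged b) @` H)) ->
    (#|S| <= #|I|)%N.
Proof.
move=> _ _ _ iO ahm iK dual _ S inequiv.
have hH := ahm_hilbert ahm; have rK := ahm_kernel ahm.
have tagI : {in S &, injective (fun a : {r : I & 'I_(d r)} => tag a)}.
  move=> [r i] [s j] Sa Sb /= rs; case: s / rs j Sb => j Sb.
  (* Two members of the subfamily attached to the same class r and distinct
     indices i, j would be equivalent through E i j. *)
  apply/eqP; apply: contraT => /(inequiv _ _ Sa Sb) [] /=.
  pose E := matrix_unit_op rG (pi r).
  rewrite -[rep_proj rG (pi r) i]/(E i i) -[rep_proj rG (pi r) j]/(E j j).
  have Ecomp := matrix_unit_op_comp rG (dual_irr dual r).
  have EH k l f : H f -> H (E k l f).
    exact: (matrix_unit_op_stable hH rK iO iK).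
  exists (E i j); split.
  - by move=> a f g _ _; apply: matrix_unit_op_linear.
  - move=> _ _ [f Hf <-] [h Hh <-].
    have ipE := ip_matrix_unit_op hH rK iO iK _ _ (dual_unitary dual r).
    have HEf := EH i i f Hf; have HEh := EH i i h Hh.
    rewrite ipE //; last exact: EH.
    by rewrite /E !Ecomp !eqxx !scale1r.
  - apply/seteqP; split=> [_ [_ [f Hf <-] <-]|_ [f Hf <-]].
      exists (E i j f); first exact: EH.
      by rewrite /E !Ecomp !eqxx.
    exists (E i i (E j i f)); first by exists (E j i f) => //; exact: EH.
    by rewrite /E !Ecomp !eqxx !scale1r.
  - by move=> p ip_p f _; apply: matrix_unit_op_pmul.
by rewrite -(card_in_imset tagI) max_card.
Qed.
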